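(* For the cycle graph $C_{4k}$ with $k\in\mathbb{N}$ (so $k\geq 1$), $$C_s(C_{4k})=4.$$
   Context: All graphs are finite, simple and undirected. $C_n$ denotes the cycle on $n$ vertices. $N(v)$ denotes the open neighborhood of a vertex $v$, and for $S\subseteq V(G)$ we write $\overline{S}=V(G)\setminus S$. A set $S\subseteq V(G)$ is a dominating set if every vertex of $\overline{S}$ is adjacent to a vertex of $S$. A dominating set $S$ is a super dominating set if for every $u\in\overline{S}$ there exists $v\in S$ with $N(v)\cap\overline{S}=\{u\}$. A super coalition partition of $G$ is a partition $\{A_1,\dots,A_m\}$ of $V(G)$ (into nonempty parts) such that (i) no part $A_i$ is a super dominating set of $G$, and (ii) for every part $A_i$ there is at least one distinct part $A_j$ ($j\neq i$) such that $A_i\cup A_j$ is a super dominating set of $G$. The super coalition number $C_s(G)$ is the maximum cardinality of a super coalition partition of $G$, with $C_s(G)=0$ if $G$ admits no super coalition partition. *)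

(* Defs.v *)
From HB Require Import structures.
From mathcomp Require Import all_boot.

Set Implicit Arguments.
Unset Strict Implicit.
Unset Printing Implicit Defensive.

Record sgraph := SGraph {
  vertex :> finType;
  adj : rel vertex;
  adj_sym : symmetric adj;
  adj_irrefl : irreflexive adj }.

Section SuperCoalition.
Variable G : sgraph.
Implicit Types (S A B : {set G}) (P : {set {set G}}).

Definition open_nbhd (v : G) : {set G} := [set u | adj v u].

Definition dominating S : bool :=
  [forall u in ~: S, [exists v in S, adj u v]].

Definition super_dominating S : bool :=
  dominating S &&
  [forall u in ~: S, [exists v in S, open_nbhd v :&: ~: S == [set u]]].

(* [partition] already requires the parts to be nonempty. *)
Definition super_coalition_partition P : bool :=
  [&& partition P [set: G],
      [forall A in P, ~~ super_dominating A] &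
      [forall A in P, [exists B in P, (B != A) && super_dominating (A :|: B)]]].

(* The maximum over an empty range is 0. *)
Definition super_coalition_number : nat :=
  \max_(P : {set {set G}} | super_coalition_partition P) #|P|.

End SuperCoalition.

(* [ordS] is the cyclic successor on 'I_n. The conjunct [i != j] only matters
   for n = 1, where it removes the loop; for n >= 3 this is the cycle C_n. *)
Definition cycle_adj (n : nat) : rel 'I_n :=
  fun i j => (i != j) && ((j == ordS i) || (i == ordS j)).

Lemma cycle_adj_sym n : symmetric (@cycle_adj n).
Proof. by move=> i j; rewrite /cycle_adj eq_sym orbC. Qed.

Lemma cycle_adj_irrefl n : irreflexive (@cycle_adj n).
Proof. by move=> i; rewrite /cycle_adj eqxx. Qed.

Definition cycle_graph (n : nat) : sgraph :=
  SGraph (@cycle_adj_sym n) (@cycle_adj_irrefl n).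

(* Main.v *)
(** Upper bound. Choosing private neighbours shows that a super dominating set
    contains at least half of the vertices, so two disjoint ones cover the graph:
    two disjoint coalition pairs exhaust the partition, which then has at most
    4 parts. With 5 parts or more the coalition pairs therefore form a star with
    some centre [A]. As [A] is not super dominating, some [u] outside [A] has no
    private neighbour, which each neighbour [v] of [u] witnesses by some
    [w v] outside [A] in [N[v] \ u]; every other part must contain [u] or one of
    the [w v], so there are at most [1 + deg u <= 3] of them.

    Lower bound. The residue classes modulo 4 form a super coalition partition,
    with coalitions {0, 1} and {2, 3}. *)
Require Import Defs.
From mathcomp Require Import all_boot.
From mathcomp Require Import zify.

Set Implicit Arguments.
Unset Strict Implicit.
Unset Printing Implicit Defensive.

(** * Super domination and coalitions in graphs of bounded degree *)

Section SuperDomination.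
Variable G : sgraph.
Implicit Types (S T A B C D : {set G}) (P : {set {set G}}).

Lemma super_dominatingP S :
  reflect (forall u, u \notin S ->
             exists2 v, v \in S & open_nbhd v :&: ~: S = [set u])
          (super_dominating S).
Proof.
apply: (iffP andP) => [[_ /forall_inP sdS] u uS | sdS].
  have /exists_inP [v vS /eqP ?] : [exists v in S, open_nbhd v :&: ~: S == [set u]].
    by apply: sdS; rewrite inE.
  by exists v.
split; apply/forall_inP => u; rewrite inE => /sdS [v vS Nv]; apply/exists_inP;
  exists v => //; last exact/eqP.
by have := set11 u; rewrite -Nv !inE adj_sym => /andP [].
Qed.

(** The map sending [v] to the part of its neighbourhood outside [S] reaches, from [S], every
    singleton [[set u]] with [u] outside [S]. *)
Lemma super_dominating_card S : super_dominating S -> #|~: S| <= #|S|.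
Proof.
move/super_dominatingP=> sdS.
rewrite -(card_imset _ set1_inj).
apply: leq_trans (leq_imset_card (fun v => open_nbhd v :&: ~: S) S).
apply/subset_leq_card/subsetP=> _ /imsetP [u uS ->].
rewrite inE in uS; have [v vS <-] := sdS _ uS; exact: imset_f.
Qed.

Lemma super_dominating_disjoint_cover S T :
  super_dominating S -> super_dominating T -> [disjoint S & T] ->
  S :|: T = [set: G].
Proof.
move=> /super_dominating_card cS /super_dominating_card cT dST.
apply/eqP; rewrite eqEcard subsetT /=.
have := cardsUI S T; rewrite (disjoint_setI0 dST) cards0.
have := cardsC S; have := cardsC T; rewrite -cardsT; lia.
Qed.

Lemma partition_mem_eq P A B x :
  partition P [set: G] -> A \in P -> B \in P -> x \in A -> x \in B -> A = B.
Proof.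
case/and3P=> _ tP _ AP BP xA xB.
by rewrite -(def_pblock tP AP xA) (def_pblock tP BP xB).
Qed.

Lemma partition_disjoint P A B :
  partition P [set: G] -> A \in P -> B \in P -> A != B -> [disjoint A & B].
Proof. by case/and3P=> _ /trivIsetP tP _ AP BP; apply: tP. Qed.

Lemma two_coalitions_card P A B C D :
  partition P [set: G] -> A \in P -> B \in P -> C \in P -> D \in P ->
  A != C -> A != D -> B != C -> B != D ->
  super_dominating (A :|: B) -> super_dominating (C :|: D) -> #|P| <= 4.
Proof.
move=> pP AP BP CP DP nAC nAD nBC nBD sAB sCD.
have dj : [disjoint A :|: B & C :|: D].
  rewrite -setI_eq0 setIUl !setIUr.
  by rewrite !disjoint_setI0 ?setU0 //; apply: (partition_disjoint pP).
have cov := super_dominating_disjoint_cover sAB sCD dj.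
(* Any element of a part [X] lies in one of the four parts, which must then equal [X]. *)
have /subset_leq_card : P \subset [set X in [:: A; B; C; D]].
  apply/subsetP=> X XP.
  have [x xX] : exists x, x \in X.
    by apply/set0Pn; case/and3P: pP => _ _; apply: contraNneq => <-.
  have := in_setT x; rewrite -cov !inE.
  by case/orP => /orP [] xY; rewrite (partition_mem_eq pP XP _ xX xY) // eqxx ?orbT.
move/leq_trans; apply.
by rewrite cardsE; apply: leq_trans (card_size _) _.
Qed.

Lemma coalition_star_card P A d :
  partition P [set: G] -> A \in P -> ~~ super_dominating A ->
  (forall v : G, #|open_nbhd v| <= d) ->
  (forall B, B \in P -> B != A -> super_dominating (A :|: B)) ->
  #|P| <= d.+2.
Proof.
move=> pP AP nsA degG star.
have [u uA bad] : exists2 u, u \notin A &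
    forall v, v \in A -> open_nbhd v :&: ~: A != [set u].
  case: (pickP [pred u | (u \notin A) &&
      [forall v in A, open_nbhd v :&: ~: A != [set u]]]) => [u | none].
    by case/andP=> uA /forall_inP bad; exists u.
  case/super_dominatingP: nsA => u uA.
  have /= := none u; rewrite uA /= => /negbT; rewrite negb_forall_in.
  by case/exists_inP => v vA /negPn /eqP ?; exists v.
(* The default [v] of [odflt] is never reached for a neighbour [v] of [u]: a failed pick would make
   [u] the only neighbour of [v] outside [A], against [bad]. *)
pose w v := if v \in A then odflt v [pick x in open_nbhd v :\ u | x \notin A] else v.
have wP v : adj u v ->
    w v \notin A /\ ((w v == v) || (w v \in open_nbhd v :\ u)).
  move=> uv; rewrite /w; case: ifPn => [vA | //]; last by rewrite eqxx.
  case: pickP => [x /andP [-> ->] | none] /=; first by rewrite orbT.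
  case/eqP: (bad v vA); apply/setP=> x.
  rewrite !inE; have := none x; rewrite !inE.
  by have [-> | _] := eqVneq x u => /=; rewrite ?uA ?andbT ?[adj v u]adj_sym.
pose H := u |: w @: open_nbhd u.
have cH : #|H| <= d.+1.
  rewrite cardsU1; have := leq_imset_card w (open_nbhd u).
  by have := degG u; case: (_ \notin _); lia.
rewrite (cardsD1 A) AP ltnS; apply: leq_trans cH.
(* Parts are counted through [pblock P], whose values on [H] include every part other than [A]. *)
apply: leq_trans (leq_imset_card (pblock P) H).
apply/subset_leq_card/subsetP=> B; rewrite !inE => /andP [nBA BP].
suff [x xH xB] : exists2 x, x \in H & x \in B.
  apply/imsetP; exists x => //; case/and3P: pP => _ tP _.
  by rewrite (def_pblock tP BP xB).
have [uB | uB] := boolP (u \in B); first by exists u; rewrite // !inE eqxx.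
have /super_dominatingP sdAB := star B BP nBA.
have [|v vAB Nv] := sdAB u; first by rewrite inE negb_or uA.
have uv : adj u v.
  by have := set11 u; rewrite -Nv !inE adj_sym => /andP [].
have [wA wv] := wP v uv; exists (w v).
  by rewrite !inE imset_f ?orbT // inE.
(* Either [w v] is [v] itself, or it is a neighbour of [v] other than [u], while [u] is the only
   neighbour of [v] outside [A :|: B]. *)
suff : w v \in A :|: B by rewrite inE (negbTE wA).
case/orP: wv => [/eqP -> // | ]; rewrite in_setD1 => /andP [nwu wN].
apply: contraNT nwu => wAB.
by rewrite -in_set1 -Nv in_setI wN in_setC.
Qed.

Lemma super_coalition_partition_card P d :
  2 <= d -> (forall v : G, #|open_nbhd v| <= d) ->
  super_coalition_partition P -> #|P| <= d.+2.
Proof.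
move=> d2 degG /and3P [pP /forall_inP nsd /forall_inP coal].
have [|P4] := leqP #|P| 4; first by lia.
have partner X : X \in P -> exists Y,
    [/\ Y \in P, Y != X & super_dominating (X :|: Y)].
  by move=> /coal /exists_inP [Y YP /andP []]; exists Y.
have cross A B C D : A \in P -> B \in P -> C \in P -> D \in P ->
    A != C -> A != D -> B != C -> B != D ->
    super_dominating (A :|: B) -> ~~ super_dominating (C :|: D).
  move=> AP BP CP DP nAC nAD nBC nBD sAB; apply/negP=> sCD.
  by have := two_coalitions_card pP AP BP CP DP nAC nAD nBC nBD sAB sCD; lia.
have [A0 A0P] : exists A, A \in P by apply/set0Pn; rewrite -card_gt0; apply: leq_trans P4.
have [B0 [B0P nBA0 sAB0]] := partner A0 A0P.
have pick2 A B C : exists X, [/\ X \in P, X != A, X != B & X != C].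
  have : 0 < #|P :\ A :\ B :\ C|.
    have step (Q : {set {set G}}) X m : m < #|Q| -> m <= #|Q :\ X|.
      by rewrite (cardsD1 X Q); case: (X \in Q) => // /ltnW.
    exact: ltnW (step _ C 2 (step _ B 3 (step P A 4 P4))).
  rewrite card_gt0 => /set0Pn [X]; rewrite !inE => /and4P [? ? ? ?].
  by exists X.
(* By [cross], the coalition partner of [C] must be [A] or [B]. *)
have edge A B C : A \in P -> B \in P -> B != A -> super_dominating (A :|: B) ->
    C \in P -> C != A -> C != B ->
    super_dominating (A :|: C) \/ super_dominating (B :|: C).
  move=> AP BP nBA sAB CP nCA nCB.
  have [D [DP nDC sCD]] := partner C CP.
  have [<- | nDA] := eqVneq D A; first by left; rewrite setUC.
  have [<- | nDB] := eqVneq D B; first by right; rewrite setUC.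
  by move: sCD; rewrite (negbTE (cross A B C D _ _ _ _ _ _ _ _ _)) // eq_sym.
(* Two coalitions sharing [A] force [A] to be the centre: a further part [X] allied with [B] would
   give a pair disjoint from [A], [C]. *)
have star A B C : A \in P -> B \in P -> B != A -> super_dominating (A :|: B) ->
    C \in P -> C != A -> C != B -> super_dominating (A :|: C) -> #|P| <= d.+2.
  move=> AP BP nBA sAB CP nCA nCB sAC.
  have off X : X \in P -> X != A -> X != B -> X != C -> super_dominating (A :|: X).
    move=> XP nXA nXB nXC; have [//|sBX] := edge A B X AP BP nBA sAB XP nXA nXB.
    by move: sBX; rewrite (negbTE (cross A C B X _ _ _ _ _ _ _ _ _)) // eq_sym.
  apply: (coalition_star_card pP AP (nsd A AP) degG) => X XP nXA.
  have [-> // | nXB] := eqVneq X B; have [-> // | nXC] := eqVneq X C.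
  exact: off.
have [C [CP nCA nCB _]] := pick2 A0 B0 B0.
have [sAC | sBC] := edge A0 B0 C A0P B0P nBA0 sAB0 CP nCA nCB.
  exact: (star A0 B0 C).
by apply: (star B0 A0 C) => //; [rewrite eq_sym | rewrite setUC].
Qed.

End SuperDomination.

(** * Cycles and their residue classes modulo 4 *)

Lemma cycle_degree n (v : cycle_graph n) : #|open_nbhd v| <= 2.
Proof.
apply: (@leq_trans #|[set ordS v; ord_pred v]|); last by rewrite cards2; case: (_ != _).
apply/subset_leq_card/subsetP=> u; rewrite !inE => /andP [_ /orP [-> //|/eqP ->]].
by rewrite ordSK eqxx orbT.
Qed.

Section ResidueClasses.
Variable k : nat.
Hypothesis k_gt0 : 0 < k.
Let G := cycle_graph (4 * k).

Definition residue_class (r : 'I_4) : {set G} := [set i : 'I_(4 * k) | i %% 4 == r].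

(** The wrap-around of [ordS] is modulo a multiple of 4, so it respects residues. *)
Lemma ordS_mod4 (i : 'I_(4 * k)) : ordS i %% 4 = i.+1 %% 4.
Proof. by rewrite /= modn_dvdm // dvdn_mulr. Qed.

Lemma cycle4E (i j : G) : adj i j = (j == ordS i) || (i == ordS j).
Proof.
rewrite /= /cycle_adj; case: eqP => // ->; rewrite orbb.
by apply/esym/negP=> /eqP /(congr1 (fun x : 'I_(4 * k) => x %% 4));
  rewrite ordS_mod4; lia.
Qed.

Lemma super_dominating_half (b : bool) :
  super_dominating ([set i : 'I_(4 * k) | (i %% 4 < 2) == b] : {set G}).
Proof.
apply/super_dominatingP=> u; rewrite inE => uS.
have [v0 ev0] : exists v, u = ordS v by exists (ord_pred u); rewrite ord_predK.
(* [x0] is the other neighbour of [v0]; when [u] opens a block, both lie in the preceding block,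
   hence in the set. *)
have [x0 ex0] : exists v, v0 = ordS v by exists (ord_pred v0); rewrite ord_predK.
have mu := ordS_mod4 v0; rewrite -ev0 in mu.
have mv0 := ordS_mod4 x0; rewrite -ex0 in mv0.
have m1 := ordS_mod4 u; have m2 := ordS_mod4 (ordS u).
(* The private neighbour of [u] is its predecessor when [u] opens a block
   {0, 1} or {2, 3}, and its successor when [u] closes it. *)
have [ue | uo] := boolP (u %% 4 \in [:: 0; 2]).
  exists v0; first by rewrite !inE in ue *; move: uS ue; case: b; lia.
  apply/setP=> x; rewrite !inE cycle4E -ev0.
  have [-> | nxu] := eqVneq x u; first by rewrite uS.
  rewrite ex0 (inj_eq (can_inj (@ordSK _))) eq_sym.
  have [-> | //] := eqVneq x x0.
  by move: uS ue; rewrite !inE; case: b; lia.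
exists (ordS u); first by rewrite !inE in uo *; move: uS uo; case: b; lia.
apply/setP=> x; rewrite !inE cycle4E.
rewrite (inj_eq (can_inj (@ordSK _))) [u == x]eq_sym.
have [-> | nxu] := eqVneq x u; first by rewrite orbT uS.
rewrite orbF; have [-> | //] := eqVneq x _.
by move: uS uo; rewrite !inE; case: b; lia.
Qed.

(** A vertex of residue [r + 2] has neighbours of residues [r + 1] and [r + 3] only, so the class
    does not dominate it. *)
Lemma residue_class_not_super_dominating r : ~~ super_dominating (residue_class r).
Proof.
have lt4 : (r + 2) %% 4 < 4 * k by lia.
pose u : 'I_(4 * k) := Ordinal lt4.
have mu : u %% 4 = (r + 2) %% 4 by rewrite /= modn_mod.
apply/negP=> /super_dominatingP /(_ u).
rewrite inE mu => -[|v]; first by have := ltn_ord r; lia.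
rewrite inE => vr /setP /(_ u); rewrite !inE eqxx cycle4E.
case/andP => /orP [] /eqP e _.
  by have := ordS_mod4 v; rewrite -e mu; have := ltn_ord r; lia.
by have := ordS_mod4 u; rewrite -e; have := ltn_ord r; lia.
Qed.

Lemma residue_class_inj : injective residue_class.
Proof.
move=> r s /setP ers; apply/val_inj.
have lt4 : r < 4 * k by have := ltn_ord r; lia.
by have := ers (Ordinal lt4); rewrite !inE /= modn_small // eqxx => /esym /eqP.
Qed.

Definition residue_partition : {set {set G}} := residue_class @: [set: 'I_4].

Lemma residue_partition_card : #|residue_partition| = 4.
Proof. by rewrite card_imset ?cardsT ?card_ord //; exact: residue_class_inj. Qed.

Lemma residue_partition_partition : partition residue_partition [set: G].
Proof.
apply/and3P; split.
- rewrite eqEsubset subsetT /=; apply/subsetP=> i _; apply/bigcupP.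
  have lt4 : (i : 'I_(4 * k)) %% 4 < 4 by rewrite ltn_mod.
  exists (residue_class (Ordinal lt4)); first by rewrite imset_f ?inE.
  by rewrite inE.
- apply/trivIsetP=> _ _ /imsetP [r _ ->] /imsetP [s _ ->] nrs.
  rewrite -setI_eq0; apply/eqP/setP=> i; rewrite !inE.
  apply: contraNF nrs => /andP [/eqP er /eqP es].
  by apply/eqP; congr (residue_class _); apply: val_inj; exact: etrans (esym er) es.
- apply/negP=> /imsetP [r _] /setP e.
  have lt4 : r < 4 * k by have := ltn_ord r; lia.
  by have := e (Ordinal lt4); rewrite !inE /= modn_small // eqxx.
Qed.

Lemma residue_super_coalition_partition :
  super_coalition_partition residue_partition.
Proof.
apply/and3P; split; first exact: residue_partition_partition.
  by apply/forall_inP=> _ /imsetP [r _ ->]; apply: residue_class_not_super_dominating.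
apply/forall_inP=> _ /imsetP [r _ ->]; apply/exists_inP.
(* The pairing exchanges 0 with 1 and 2 with 3. *)
pose s : 'I_4 := inord (if odd r then r.-1 else r.+1).
have es : s = (if odd r then r.-1 else r.+1) :> nat.
  by rewrite inordK //; have := ltn_ord r; case: ifP; lia.
exists (residue_class s); first by rewrite imset_f ?inE.
rewrite (inj_eq residue_class_inj); apply/andP; split.
  by apply/eqP=> /(congr1 val) /=; rewrite es; case: ifP; lia.
suff -> : residue_class r :|: residue_class s =
    ([set i : 'I_(4 * k) | (i %% 4 < 2) == (r < 2)] : {set G}).
  exact: super_dominating_half.
apply/setP=> i; rewrite !inE es; have := ltn_ord r.
by case: ifP; lia.
Qed.

End ResidueClasses.

Theorem theorem5p6 (k : nat) (hk : 1 <= k) :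
  super_coalition_number (cycle_graph (4 * k)) = 4.
Proof.
apply/eqP; rewrite eqn_leq; apply/andP; split.
  (* The general bound [d.+2] is used with degree bound 2. *)
  apply/bigmax_leqP=> P; apply: super_coalition_partition_card => //.
  exact: cycle_degree.
apply: (bigmax_sup (residue_partition k)).
  exact: residue_super_coalition_partition.
by rewrite residue_partition_card.
Qed.
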